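(* Let $A=D[x,y;\sigma,\tau,a]$ be a generalized Weyl algebra such that the elements $a$ and $\sigma(a)$ are right normal in $D$ (hence normal in $D$, since they are left normal by the definition of a generalized Weyl algebra). Then the following statements are equivalent. 1. $A$ is a simple ring. 2. (a) The elements $a$ and $\sigma(a)$ are regular in $D$; (b) $D$ is a $\sigma$-simple ring; (c) for all $i\ge 1$, $\sigma^i$ is not an inner automorphism of the ring $D$; and (d) for all $i\ge 1$, $Da+D\sigma^i(a)=D$. 3. (a) The elements $a$ and $\sigma(a)$ are regular in $D$; (b) $D$ is a $\tau$-simple ring; (c) for all $i\ge 1$, $\tau^i$ is not an inner automorphism of the ring $D$; and (d) for all $i\ge 1$, $D\sigma(a)+D\tau^i\sigma(a)=D$. If one of the equivalent conditions holds then $\sigma$ and $\tau$ are automorphisms of $D$.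
   Context: Generalized Weyl algebra (GWA): let $D$ be a ring (associative, with 1), $\sigma,\tau$ ring endomorphisms of $D$ and $a\in D$ such that $\tau\sigma(a)=a$, $ad=\tau\sigma(d)a$ and $\sigma(a)d=\sigma\tau(d)\sigma(a)$ for all $d\in D$. Then $A=D[x,y;\sigma,\tau,a]$ is the ring generated by $D$, $x$ and $y$ subject to the defining relations $xd=\sigma(d)x$, $yd=\tau(d)y$ for all $d\in D$, $yx=a$, $xy=\sigma(a)$. (Products of endomorphisms are compositions.) An element $d\in D$ is left normal if $dD\subseteq Dd$, right normal if $Dd\subseteq dD$, normal if $Dd=dD$. An element is regular if it is neither a left nor a right zero divisor. For a ring endomorphism $\sigma$ of $D$, an ideal $I$ of $D$ is $\sigma$-stable if $\sigma(I)\subseteq I$; $D$ is $\sigma$-simple if $0$ and $D$ are its only $\sigma$-stable ideals. An endomorphism $\sigma$ is inner if there is a unit $u\in D$ with $\sigma(d)=udu^{-1}$ for all $d\in D$. *)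

(* Defs.v *)
From HB Require Import structures.
From mathcomp Require Import all_boot all_order all_algebra.
From mathcomp Require Import boolp classical_sets.

Set Implicit Arguments.
Unset Strict Implicit.
Unset Printing Implicit Defensive.

Import GRing.Theory.

Local Open Scope quotient_scope.
Local Open Scope classical_set_scope.
Local Open Scope ring_scope.

Section RingNotions.
Variable R : pzRingType.

Definition lmultiples (d : R) : set R := [set r * d | r in setT].
Definition rmultiples (d : R) : set R := [set d * r | r in setT].

Definition sum_set (I J : set R) : set R := [set u + v | u in I & v in J].

Definition left_normal (d : R) : Prop := rmultiples d `<=` lmultiples d.
Definition right_normal (d : R) : Prop := lmultiples d `<=` rmultiples d.

Definition left_zero_divisor (d : R) : Prop := exists2 r : R, r != 0 & d * r = 0.
Definition right_zero_divisor (d : R) : Prop := exists2 r : R, r != 0 & r * d = 0.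
Definition regular (d : R) : Prop :=
  ~ left_zero_divisor d /\ ~ right_zero_divisor d.

(* Closure under opposites follows from closure under multiplication by -1. *)
Definition two_sided_ideal (I : set R) : Prop :=
  [/\ I 0,
      forall u v, I u -> I v -> I (u + v),
      forall r u, I u -> I (r * u) &
      forall r u, I u -> I (u * r)].

(* A pzRingType may be the zero ring, which is not simple. *)
Definition simple_ring : Prop :=
  (1 : R) <> 0 /\
  forall I : set R, two_sided_ideal I -> I = [set 0] \/ I = setT.

Definition stable (s : R -> R) (I : set R) : Prop := s @` I `<=` I.

Definition endo_simple (s : R -> R) : Prop :=
  forall I : set R, two_sided_ideal I -> stable s I -> I = [set 0] \/ I = setT.

Definition inner (s : R -> R) : Prop :=
  exists u v : R, [/\ u * v = 1, v * u = 1 & forall d, s d = u * d * v].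

End RingNotions.

Definition gwa_conditions (D : pzRingType) (sigma tau : {rmorphism D -> D})
    (a : D) : Prop :=
  [/\ tau (sigma a) = a,
      forall d, a * d = tau (sigma d) * a &
      forall d, sigma a * d = sigma (tau d) * sigma a].

(* D[x, y; sigma, tau, a] is built as the set of ring expressions in x, y and  *)
(* the elements of D, modulo the smallest congruence containing the axioms of  *)
(* rings, the operations of D and the defining relations.                      *)
Inductive gwa_term (D : Type) : Type :=
  | TConst of D
  | TX
  | TY
  | TOpp of gwa_term D
  | TAdd of gwa_term D & gwa_term D
  | TMul of gwa_term D & gwa_term D.

Arguments TX {D}.
Arguments TY {D}.

HB.instance Definition _ (D : Type) := gen_eqMixin (gwa_term D).
HB.instance Definition _ (D : Type) := gen_choiceMixin (gwa_term D).

Section GWA.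
Variables (D : pzRingType) (sigma tau : {rmorphism D -> D}) (a : D).

Local Notation term := (gwa_term D).
Local Notation C := (@TConst D).

Inductive gwa_cong : term -> term -> Prop :=
  | cong_refl t : gwa_cong t t
  | cong_sym t u : gwa_cong t u -> gwa_cong u t
  | cong_trans t u v : gwa_cong t u -> gwa_cong u v -> gwa_cong t v
  | cong_opp t t' : gwa_cong t t' -> gwa_cong (TOpp t) (TOpp t')
  | cong_add t t' u u' : gwa_cong t t' -> gwa_cong u u' ->
      gwa_cong (TAdd t u) (TAdd t' u')
  | cong_mul t t' u u' : gwa_cong t t' -> gwa_cong u u' ->
      gwa_cong (TMul t u) (TMul t' u')
  | cong_addA t u v : gwa_cong (TAdd t (TAdd u v)) (TAdd (TAdd t u) v)
  | cong_addC t u : gwa_cong (TAdd t u) (TAdd u t)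
  | cong_add0 t : gwa_cong (TAdd (C 0) t) t
  | cong_addN t : gwa_cong (TAdd (TOpp t) t) (C 0)
  | cong_mulA t u v : gwa_cong (TMul t (TMul u v)) (TMul (TMul t u) v)
  | cong_mul1l t : gwa_cong (TMul (C 1) t) t
  | cong_mul1r t : gwa_cong (TMul t (C 1)) t
  | cong_mulDl t u v :
      gwa_cong (TMul (TAdd t u) v) (TAdd (TMul t v) (TMul u v))
  | cong_mulDr t u v :
      gwa_cong (TMul t (TAdd u v)) (TAdd (TMul t u) (TMul t v))
  | cong_constD c d : gwa_cong (C (c + d)) (TAdd (C c) (C d))
  | cong_constM c d : gwa_cong (C (c * d)) (TMul (C c) (C d))
  | cong_xd d : gwa_cong (TMul TX (C d)) (TMul (C (sigma d)) TX)
  | cong_yd d : gwa_cong (TMul TY (C d)) (TMul (C (tau d)) TY)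
  | cong_yx : gwa_cong (TMul TY TX) (C a)
  | cong_xy : gwa_cong (TMul TX TY) (C (sigma a)).

Definition gwa_rel : rel term := fun t u => `[< gwa_cong t u >].

Lemma gwa_rel_refl : reflexive gwa_rel.
Proof. by move=> t; apply/asboolP; exact: cong_refl. Qed.

Lemma gwa_rel_sym : symmetric gwa_rel.
Proof. by move=> t u; apply/asboolP/asboolP; exact: cong_sym. Qed.

Lemma gwa_rel_trans : transitive gwa_rel.
Proof.
by move=> t u v /asboolP utP /asboolP tvP; apply/asboolP; exact: cong_trans tvP.
Qed.

Canonical gwa_equiv := EquivRel gwa_rel gwa_rel_refl gwa_rel_sym gwa_rel_trans.

Definition gwa := {eq_quot gwa_rel}.
HB.instance Definition _ := Choice.on gwa.

Definition gwa_class (t : term) : gwa := \pi_{eq_quot gwa_rel} t.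
Definition gwa_repr (p : gwa) : term := repr (p : {eq_quot gwa_rel}).

Lemma gwa_classP t u : gwa_cong t u <-> gwa_class t = gwa_class u.
Proof.
split=> [tuP|/eqmodP /asboolP //]; apply/eqmodP; exact/asboolP.
Qed.

Lemma gwa_reprK p : gwa_class (gwa_repr p) = p.
Proof. exact: reprK. Qed.

Lemma gwa_repr_class t : gwa_cong (gwa_repr (gwa_class t)) t.
Proof. by apply/gwa_classP; rewrite gwa_reprK. Qed.

Lemma gwaW (P : gwa -> Prop) : (forall t, P (gwa_class t)) -> forall p, P p.
Proof. by move=> PC p; rewrite -[p]gwa_reprK; exact: PC. Qed.

Definition gwa_add (p q : gwa) : gwa := gwa_class (TAdd (gwa_repr p) (gwa_repr q)).
Definition gwa_opp (p : gwa) : gwa := gwa_class (TOpp (gwa_repr p)).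
Definition gwa_mul (p q : gwa) : gwa := gwa_class (TMul (gwa_repr p) (gwa_repr q)).

Lemma gwa_class_add t u : gwa_add (gwa_class t) (gwa_class u) = gwa_class (TAdd t u).
Proof. by apply/gwa_classP/cong_add; exact: gwa_repr_class. Qed.

Lemma gwa_class_opp t : gwa_opp (gwa_class t) = gwa_class (TOpp t).
Proof. by apply/gwa_classP/cong_opp; exact: gwa_repr_class. Qed.

Lemma gwa_class_mul t u : gwa_mul (gwa_class t) (gwa_class u) = gwa_class (TMul t u).
Proof. by apply/gwa_classP/cong_mul; exact: gwa_repr_class. Qed.

Let piE := (gwa_class_add, gwa_class_opp, gwa_class_mul).

Fact gwa_addA : associative gwa_add.
Proof.
elim/gwaW=> t; elim/gwaW=> u; elim/gwaW=> v; rewrite !piE.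
by apply/gwa_classP; exact: cong_addA.
Qed.

Fact gwa_addC : commutative gwa_add.
Proof.
elim/gwaW=> t; elim/gwaW=> u; rewrite !piE.
by apply/gwa_classP; exact: cong_addC.
Qed.

Fact gwa_add0 : left_id (gwa_class (C 0)) gwa_add.
Proof. by elim/gwaW=> t; rewrite !piE; apply/gwa_classP; exact: cong_add0. Qed.

Fact gwa_addN : left_inverse (gwa_class (C 0)) gwa_opp gwa_add.
Proof. by elim/gwaW=> t; rewrite !piE; apply/gwa_classP; exact: cong_addN. Qed.

Fact gwa_mulA : associative gwa_mul.
Proof.
elim/gwaW=> t; elim/gwaW=> u; elim/gwaW=> v; rewrite !piE.
by apply/gwa_classP; exact: cong_mulA.
Qed.

Fact gwa_mul1l : left_id (gwa_class (C 1)) gwa_mul.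
Proof. by elim/gwaW=> t; rewrite !piE; apply/gwa_classP; exact: cong_mul1l. Qed.

Fact gwa_mul1r : right_id (gwa_class (C 1)) gwa_mul.
Proof. by elim/gwaW=> t; rewrite !piE; apply/gwa_classP; exact: cong_mul1r. Qed.

Fact gwa_mulDl : left_distributive gwa_mul gwa_add.
Proof.
elim/gwaW=> t; elim/gwaW=> u; elim/gwaW=> v; rewrite !piE.
by apply/gwa_classP; exact: cong_mulDl.
Qed.

Fact gwa_mulDr : right_distributive gwa_mul gwa_add.
Proof.
elim/gwaW=> t; elim/gwaW=> u; elim/gwaW=> v; rewrite !piE.
by apply/gwa_classP; exact: cong_mulDr.
Qed.

HB.instance Definition _ := GRing.isPzRing.Build gwa
  gwa_addA gwa_addC gwa_add0 gwa_addN gwa_mulA gwa_mul1l gwa_mul1r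
  gwa_mulDl gwa_mulDr.

Definition gwa_const (d : D) : gwa := gwa_class (C d).
Definition gwa_x : gwa := gwa_class TX.
Definition gwa_y : gwa := gwa_class TY.

Lemma gwa_class_addE t u : gwa_class (TAdd t u) = gwa_class t + gwa_class u.
Proof. by rewrite -gwa_class_add. Qed.

Lemma gwa_class_oppE t : gwa_class (TOpp t) = - gwa_class t.
Proof. by rewrite -gwa_class_opp. Qed.

Lemma gwa_class_mulE t u : gwa_class (TMul t u) = gwa_class t * gwa_class u.
Proof. by rewrite -gwa_class_mul. Qed.

Fact gwa_const_zmod : zmod_morphism gwa_const.
Proof.
have cD c d : gwa_const (c + d) = gwa_const c + gwa_const d.
  by rewrite -gwa_class_addE; apply/gwa_classP; exact: cong_constD.
by move=> c d; apply/eqP; rewrite eq_sym subr_eq -cD subrK.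
Qed.

Fact gwa_const_monoid : monoid_morphism gwa_const.
Proof.
split=> // c d.
by rewrite -gwa_class_mulE; apply/gwa_classP; exact: cong_constM.
Qed.

HB.instance Definition _ :=
  GRing.isZmodMorphism.Build D gwa gwa_const gwa_const_zmod.
HB.instance Definition _ :=
  GRing.isMonoidMorphism.Build D gwa gwa_const gwa_const_monoid.

Lemma gwa_xd d : gwa_x * gwa_const d = gwa_const (sigma d) * gwa_x.
Proof. by rewrite -!gwa_class_mulE; apply/gwa_classP; exact: cong_xd. Qed.

Lemma gwa_yd d : gwa_y * gwa_const d = gwa_const (tau d) * gwa_y.
Proof. by rewrite -!gwa_class_mulE; apply/gwa_classP; exact: cong_yd. Qed.

Lemma gwa_yx : gwa_y * gwa_x = gwa_const a.
Proof. by rewrite -gwa_class_mulE; apply/gwa_classP; exact: cong_yx. Qed.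

Lemma gwa_xy : gwa_x * gwa_y = gwa_const (sigma a).
Proof. by rewrite -gwa_class_mulE; apply/gwa_classP; exact: cong_xy. Qed.

Section UniversalProperty.
Variables (B : pzRingType) (f : {rmorphism D -> B}) (x y : B).
Hypotheses (xd : forall d, x * f d = f (sigma d) * x)
           (yd : forall d, y * f d = f (tau d) * y)
           (yx : y * x = f a) (xy : x * y = f (sigma a)).

Fixpoint gwa_eval (t : term) : B :=
  match t with
  | TConst d => f d
  | TX => x
  | TY => y
  | TOpp t => - gwa_eval t
  | TAdd t u => gwa_eval t + gwa_eval u
  | TMul t u => gwa_eval t * gwa_eval u
  end.

Lemma gwa_eval_cong t u : gwa_cong t u -> gwa_eval t = gwa_eval u.
Proof.
by elim=> //= {t u} *;
  rewrite ?rmorph0 ?rmorph1 ?rmorphD ?rmorphM ?addrA ?add0r ?addNr ?mulrA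
          ?mul1r ?mulr1 ?mulrDl ?mulrDr //; (congruence || exact: addrC).
Qed.

Lemma gwa_universal :
  exists2 g : {rmorphism gwa -> B},
    [/\ forall d, g (gwa_const d) = f d, g gwa_x = x & g gwa_y = y] &
    forall h : {rmorphism gwa -> B},
      [/\ forall d, h (gwa_const d) = f d, h gwa_x = x & h gwa_y = y] ->
      h =1 g.
Proof.
pose g (p : gwa) := gwa_eval (gwa_repr p).
have gE t : g (gwa_class t) = gwa_eval t.
  by apply: gwa_eval_cong; exact: gwa_repr_class.
have gB : zmod_morphism g.
  elim/gwaW=> t; elim/gwaW=> u.
  by rewrite -gwa_class_oppE -gwa_class_addE !gE.
have gM : monoid_morphism g.
  split=> [|]; first by rewrite -[1]/(gwa_class (C 1)) gE /= rmorph1.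
  by elim/gwaW=> t; elim/gwaW=> u; rewrite -gwa_class_mulE !gE.
pose gZ := GRing.isZmodMorphism.Build gwa B g gB.
pose gR := GRing.isMonoidMorphism.Build gwa B g gM.
pose G : {rmorphism gwa -> B} := HB.pack g gZ gR.
exists G => [|h [hC hX hY]]; first by split=> [d||]; exact: gE.
elim/gwaW=> t; rewrite [RHS]gE.
elim: t => [d|||t IHt|t IHt u IHu|t IHt u IHu] //=.
- exact: hC.
- by rewrite gwa_class_oppE rmorphN IHt.
- by rewrite gwa_class_addE rmorphD IHt IHu.
- by rewrite gwa_class_mulE rmorphM IHt IHu.
Qed.

End UniversalProperty.
End GWA.

(* Main.v *)
Require Import Defs.
From HB Require Import structures.
From mathcomp Require Import all_boot all_order all_algebra.
From mathcomp Require Import boolp classical_sets.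
From mathcomp Require Import zify.

Import GRing.Theory Num.Theory.

Local Open Scope classical_set_scope.
Local Open Scope ring_scope.

Set Implicit Arguments.
Unset Strict Implicit.
Unset Printing Implicit Defensive.

(** Everything rests on the fact that A = D[x, y; sigma, tau, a] is a free left
    D-module with basis v_i = x^i (i >= 0), v_(-i) = y^i. The relations let one
    write down how x, y and D ought to act on families of coefficients indexed
    by the integers; that this is compatible with all the relations
    [gwa_act_cong] gives well-defined coefficient functions, and the v_i span
    [gwa_span]. The Z-grading then controls products [gwa_coefM_homogeneous].

    The exchange of (x, sigma, a) with (y, tau, sigma a) is an isomorphism onto
    D[x, y; tau, sigma, sigma a] [simple_gwa_swap]. It carries condition 2 to
    condition 3, so only the equivalence of 1 and 2 has to be proved
    [simple_gwa_iff].

    Suppose that A is simple. If I is a sigma-stable ideal of D, the p such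
    that x^n p lies in I[x; sigma] for some n form an ideal of A, which is
    proper when I is; hence D is sigma-simple, and the case I = 0 shows that x
    is left regular. By symmetry so is y, and comparing coefficients gives
    sigma(d) sigma(a) = 0 => d = 0 and tau(d) a = 0 => d = 0. Together with
    normality these two implications are equivalent to the regularity of a and
    sigma(a), and they make sigma and tau bijective [twisted_regularP,
    twisted_bijective]. If a power of sigma were inner, a further power would
    be conjugation by a sigma-fixed unit u [inner_iter_fixed_unit], whence a
    central element z = u^-1 x^n of positive degree; 1 + z is then a central
    nonzero nonunit. Finally the elements of degree 0 in A x^i A are seen to
    lie in Da + D sigma^i(a), so this ideal contains 1.

    Conversely let J be a nonzero ideal of A. As x is left regular, J contains
    nonzero polynomials in x; take one whose support lies in an interval
    [m, m + n] with n least possible. By sigma-simplicity its lowest coefficient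
    may be taken to be 1. Commuting it with D and x lowers the length of the
    support, so it gives 0: if n > 0, the coefficient c of x^(m + n) is
    sigma-fixed and satisfies c sigma^n(r) = r c, so that D c is a sigma-stable
    ideal, c is a unit and sigma^n is inner. Hence n = 0 and x^m is in J. Now
    y x^m = a x^(m - 1) and x^m y = sigma^m(a) x^(m - 1), so the comaximality of
    a and sigma^m(a) puts x^(m - 1) in J, and 1 is in J by descent. *)

(** * The basis of monomials and the grading *)

Section Coefficients.
Variables (D : pzRingType) (sigma tau : {rmorphism D -> D}) (a : D).
Hypothesis gwaP : gwa_conditions sigma tau a.

Local Notation A := (gwa sigma tau a).
Local Notation K := (@gwa_const D sigma tau a).
Local Notation x := (gwa_x sigma tau a).
Local Notation y := (gwa_y sigma tau a).

(** Left multiplication by [t], on families (f_i) standing for the formal sums of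
    the f_i v_i: x (f v_i) = sigma(f) v_(i+1) for i >= 0, while for i < 0 a
    factor xy = sigma(a) appears, and dually for y. Acting on all
    families, that is, on formal infinite sums, keeps them plain functions. *)
Fixpoint gwa_act (t : gwa_term D) (f : int -> D) : int -> D :=
  match t with
  | TConst d => fun i => d * f i
  | TX => fun i => sigma (f (i - 1)) * (if 0 < i then 1 else sigma a)
  | TY => fun i => tau (f (i + 1)) * (if i < 0 then 1 else a)
  | TOpp t => fun i => - gwa_act t f i
  | TAdd t u => fun i => gwa_act t f i + gwa_act u f i
  | TMul t u => gwa_act t (gwa_act u f)
  end.

Lemma gwa_actD t f g :
  gwa_act t (fun i => f i + g i) = fun i => gwa_act t f i + gwa_act t g i.
Proof.
elim: t f g => [d|||t IHt|t IHt u IHu|t IHt u IHu] f g /=.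
- by apply/funext => i; rewrite mulrDr.
- by apply/funext => i; rewrite rmorphD mulrDl.
- by apply/funext => i; rewrite rmorphD mulrDl.
- by apply/funext => i; rewrite IHt opprD.
- by apply/funext => i; rewrite IHt IHu addrACA.
- by rewrite IHu IHt.
Qed.

(** This is the point where the compatibility conditions on sigma, tau and a are
    used: they say exactly that yx and xy act as a and sigma(a). *)
Lemma gwa_act_cong t u : gwa_cong sigma tau a t u -> gwa_act t = gwa_act u.
Proof.
have [tsa ad sad] := gwaP.
elim=> {t u} /=.
- by [].
- by move=> t u _ ->.
- by move=> t u v _ -> _ ->.
- by move=> t u _ ->.
- by move=> t t' u u' _ -> _ ->.
- by move=> t t' u u' _ -> _ ->.
- by move=> t u v; do 2!apply/funext=> ?; rewrite addrA.
- by move=> t u; do 2!apply/funext=> ?; rewrite addrC.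
- by move=> t; do 2!apply/funext=> ?; rewrite mul0r add0r.
- by move=> t; do 2!apply/funext=> ?; rewrite mul0r addNr.
- by [].
- by move=> t; do 2!apply/funext=> ?; rewrite mul1r.
- by move=> t; apply/funext=> f; congr gwa_act; apply/funext=> i; rewrite mul1r.
- by [].
- by move=> t u v; apply/funext=> f; rewrite gwa_actD.
- by move=> c d; do 2!apply/funext=> ?; rewrite mulrDl.
- by move=> c d; do 2!apply/funext=> ?; rewrite mulrA.
- by move=> d; do 2!apply/funext=> ?; rewrite rmorphM mulrA.
- by move=> d; do 2!apply/funext=> ?; rewrite rmorphM mulrA.
- apply/funext=> f; apply/funext=> i; rewrite addrK rmorphM -mulrA ad.
  have [i0|i0] := ltrP i 0.
    by rewrite ifF ?mulr1 ?tsa //; apply/negbTE; lia.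
  by rewrite ifT ?rmorph1 ?mul1r //; lia.
- apply/funext=> f; apply/funext=> i; rewrite subrK rmorphM -mulrA sad.
  have [i0|i0] := ltrP 0 i.
    by rewrite ifF ?mulr1 //; apply/negbTE; lia.
  by rewrite ifT ?rmorph1 ?mul1r //; lia.
Qed.

(** The unit family represents 1, so acting on it recovers the element. *)
Definition gwa_coef (p : A) : int -> D :=
  gwa_act (gwa_repr p) (fun i => (i == 0)%:R).

Local Notation coef := gwa_coef.

Lemma gwa_coef_class t : coef (gwa_class sigma tau a t) = gwa_act t (fun i => (i == 0)%:R).
Proof. by rewrite /coef (gwa_act_cong (gwa_repr_class _ _ _ t)). Qed.

Lemma gwa_coefD p q i : coef (p + q) i = coef p i + coef q i.
Proof.
elim/gwaW: p => t; elim/gwaW: q => u.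
by rewrite -gwa_class_addE !gwa_coef_class.
Qed.

Lemma gwa_coefN p i : coef (- p) i = - coef p i.
Proof. by elim/gwaW: p => t; rewrite -gwa_class_oppE !gwa_coef_class. Qed.

Lemma gwa_coefB p q i : coef (p - q) i = coef p i - coef q i.
Proof. by rewrite gwa_coefD gwa_coefN. Qed.

Lemma gwa_coefC d i : coef (K d) i = d * (i == 0)%:R.
Proof. by rewrite gwa_coef_class. Qed.

Lemma gwa_coef0 i : coef 0 i = 0.
Proof. by rewrite -(rmorph0 K) gwa_coefC mul0r. Qed.

Lemma gwa_coef1 i : coef 1 i = (i == 0)%:R.
Proof. by rewrite -(rmorph1 K) gwa_coefC mul1r. Qed.

Lemma gwa_coefCM d p i : coef (K d * p) i = d * coef p i.
Proof. by elim/gwaW: p => t; rewrite -gwa_class_mulE !gwa_coef_class. Qed.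

Lemma gwa_coefXM p i :
  coef (x * p) i = sigma (coef p (i - 1)) * (if 0 < i then 1 else sigma a).
Proof. by elim/gwaW: p => t; rewrite -gwa_class_mulE !gwa_coef_class. Qed.

Lemma gwa_coefYM p i :
  coef (y * p) i = tau (coef p (i + 1)) * (if i < 0 then 1 else a).
Proof. by elim/gwaW: p => t; rewrite -gwa_class_mulE !gwa_coef_class. Qed.

(** Negation is multiplication by the constant -1, hence needs no case. *)
Lemma gwa_ind (P : A -> Prop) :
    (forall d, P (K d)) -> P x -> P y ->
    (forall p q, P p -> P q -> P (p + q)) ->
    (forall p q, P p -> P q -> P (p * q)) ->
  forall p, P p.
Proof.
move=> PC PX PY PD PM; elim/gwaW.
elim=> [d|||t IHt|t IHt u IHu|t IHt u IHu].
- exact: PC.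
- exact: PX.
- exact: PY.
- by rewrite gwa_class_oppE -mulN1r -(rmorph1 K) -rmorphN; apply: PM => //; exact: PC.
- by rewrite gwa_class_addE; apply: PD.
- by rewrite gwa_class_mulE; apply: PM.
Qed.

Definition gwa_mon (i : int) : A :=
  match i with Posz n => x ^+ n | Negz n => y ^+ n.+1 end.

Local Notation v := gwa_mon.

Lemma gwa_coef_mon i j : coef (v i) j = (j == i)%:R.
Proof.
case: i => n /=.
  elim: n j => [|n IHn] j; first by rewrite expr0 gwa_coef1.
  rewrite exprS gwa_coefXM IHn rmorph_nat.
  have [->|nj] := eqVneq j n.+1.
    have -> : n.+1%:Z - 1 = n by lia.
    by rewrite eqxx mul1r.
  by case: eqP => [|_]; [lia|rewrite mul0r].
rewrite NegzE; elim: n.+1 j => {n} [|n IHn] j.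
  by rewrite expr0 gwa_coef1 oppr0.
rewrite exprS gwa_coefYM IHn rmorph_nat.
have [->|nj] := eqVneq j (- n.+1%:Z).
  have -> : - n.+1%:Z + 1 = - n%:Z by lia.
  by rewrite eqxx mul1r.
by case: eqP => [|_]; [lia|rewrite mul0r].
Qed.

Lemma gwa_coefCmon d i j : coef (K d * v i) j = d * (j == i)%:R.
Proof. by rewrite gwa_coefCM gwa_coef_mon. Qed.

Definition homogeneous (i : int) (p : A) : Prop := exists d, p = K d * v i.

Lemma homogeneousC d : homogeneous 0 (K d).
Proof. by exists d; rewrite mulr1. Qed.

Lemma homogeneous_mon i : homogeneous i (v i).
Proof. by exists 1; rewrite rmorph1 mul1r. Qed.

Lemma homogeneousCM d i p : homogeneous i p -> homogeneous i (K d * p).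
Proof. by move=> [c ->]; exists (d * c); rewrite rmorphM mulrA. Qed.

Lemma homogeneousXM i p : homogeneous i p -> homogeneous (1 + i) (x * p).
Proof.
move=> [d ->]; rewrite mulrA gwa_xd -mulrA; apply: homogeneousCM.
case: i => [n|[|n]] /=.
- by rewrite -exprS; exact: homogeneous_mon (Posz n.+1).
- by rewrite expr1 gwa_xy; exact: homogeneousC.
- rewrite exprS mulrA gwa_xy; apply: homogeneousCM.
  have -> : 1 + Negz n.+1 = Negz n by lia.
  exact: homogeneous_mon (Negz n).
Qed.

Lemma homogeneousYM i p : homogeneous i p -> homogeneous (-1 + i) (y * p).
Proof.
move=> [d ->]; rewrite mulrA gwa_yd -mulrA; apply: homogeneousCM.
case: i => [[|n]|n] /=.
- by rewrite expr0 mulr1; exact: homogeneous_mon (Negz 0).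
- rewrite exprS mulrA gwa_yx; apply: homogeneousCM.
  have -> : -1 + n.+1%:Z = n by lia.
  exact: homogeneous_mon (Posz n).
- rewrite -exprS.
  have -> : -1 + Negz n = Negz n.+1 by lia.
  exact: homogeneous_mon (Negz n.+1).
Qed.

(** It suffices to let the letters x and y act on the left one at a time. *)
Lemma homogeneousM i j p q :
  homogeneous i p -> homogeneous j q -> homogeneous (i + j) (p * q).
Proof.
move=> [d ->] hq; rewrite -mulrA; apply: homogeneousCM.
case: i => n /=.
  elim: n => [|n IHn]; first by rewrite mul1r add0r.
  by rewrite exprS -mulrA -addn1 PoszD [_ + 1]addrC -addrA; apply: homogeneousXM.
rewrite NegzE; elim: n.+1 => {n} [|n IHn]; first by rewrite mul1r oppr0 add0r.
rewrite exprS -mulrA -addn1 PoszD [n%:Z + 1]addrC opprD -addrA.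
exact: homogeneousYM.
Qed.

Lemma gwa_coef_homogeneous i j p : homogeneous i p -> j != i -> coef p j = 0.
Proof. by move=> [d ->] /negbTE ji; rewrite gwa_coefCmon ji mulr0. Qed.

(** The span of the monomials contains 1 and is stable under left
    multiplication by the generators. *)
Lemma gwa_span (p : A) :
  exists s : seq (D * int), p = \sum_(e <- s) K e.1 * v e.2.
Proof.
pose S (p : A) := exists s : seq (D * int), p = \sum_(e <- s) K e.1 * v e.2.
have SD p1 p2 : S p1 -> S p2 -> S (p1 + p2).
  by move=> [s1 ->] [s2 ->]; exists (s1 ++ s2); rewrite big_cat.
have Sh i q : homogeneous i q -> S q.
  by move=> [d ->]; exists [:: (d, i)]; rewrite big_seq1.
have ShM h : (forall i q, homogeneous i q -> S (h * q)) -> forall q, S q -> S (h * q).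
  move=> hS q [s ->]; elim: s => [|e s IHs].
    by rewrite big_nil mulr0; exists [::]; rewrite big_nil.
  by rewrite big_cons mulrDr; apply: SD => //; apply/hS/homogeneousCM/homogeneous_mon.
suff SM q : S q -> S (p * q).
  by rewrite -[p]mulr1 -(rmorph1 K); apply/SM/Sh/homogeneousC.
elim/gwa_ind: p q => [d|||p q IHp IHq|p q IHp IHq].
- by apply: ShM => i q hq; exact/Sh/homogeneousCM/hq.
- by apply: ShM => i q hq; exact/Sh/homogeneousXM/hq.
- by apply: ShM => i q hq; exact/Sh/homogeneousYM/hq.
- by move=> r Sr; rewrite mulrDl; apply: SD; auto.
- by move=> r Sr; rewrite -mulrA; auto.
Qed.

Lemma gwa_homogeneous_ind (P : A -> Prop) :
    P 0 -> (forall p q, P p -> P q -> P (p + q)) ->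
    (forall d i, P (K d * v i)) ->
  forall p, P p.
Proof.
move=> P0 PD Pv p; have [s ->] := gwa_span p.
by elim: s => [|e s IHs]; rewrite ?big_nil ?big_cons //; apply: PD.
Qed.

Lemma gwa_coef_sum (s : seq (D * int)) i :
  coef (\sum_(e <- s) K e.1 * v e.2) i = \sum_(e <- s | e.2 == i) e.1.
Proof.
elim: s => [|e s IHs]; first by rewrite !big_nil gwa_coef0.
rewrite !big_cons gwa_coefD IHs gwa_coefCmon eq_sym.
by case: (_ == _); rewrite ?mulr1 // mulr0 add0r.
Qed.

(** Coefficients determine an element: after grouping the terms of equal degree
    in a linear combination of monomials, the coefficients are read off. *)
Lemma gwa_coef_inj p : (forall i, coef p i = 0) -> p = 0.
Proof.
have [s ->] := gwa_span p => s0.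
pose r := undup [seq e.2 | e <- s].
transitivity (\sum_(e <- s) \sum_(i <- r | i == e.2) K e.1 * v i).
  apply: eq_big_seq => e es.
  have er : e.2 \in r by rewrite mem_undup map_f.
  rewrite big_mkcond (bigD1_seq e.2) ?undup_uniq //= eqxx big1 ?addr0 //.
  by move=> i /negbTE ->.
rewrite (exchange_big_dep xpredT) //= big1 // => i _.
rewrite -mulr_suml -(raddf_sum K).
have := s0 i; rewrite gwa_coef_sum.
by under eq_bigl do rewrite eq_sym; move=> ->; rewrite raddf0 mul0r.
Qed.

Lemma gwa_coef_support p : exists N : nat, forall i, (N%:Z < `|i|) -> coef p i = 0.
Proof.
elim/gwa_homogeneous_ind: p => [|p q [N hN] [M hM]|d i].
- by exists 0%N => i _; rewrite gwa_coef0.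
- exists (maxn N M) => i hi; rewrite gwa_coefD hN ?hM ?addr0 //; lia.
- exists `|i|%N => j hj; rewrite gwa_coefCmon.
  by case: eqP => [|_]; [lia|rewrite mulr0].
Qed.

(** Right multiplication by a homogeneous element acts degree by degree, each
    coefficient being multiplied on the right by a scalar that depends only on
    the degree. *)
Lemma gwa_coefM_homogeneous p h i j : homogeneous j h ->
  coef (p * h) (i + j) = coef p i * coef (v i * h) (i + j).
Proof.
move=> hh; elim/gwa_homogeneous_ind: p => [|p q IHp IHq|d k].
- by rewrite mul0r !gwa_coef0 mul0r.
- by rewrite mulrDl !gwa_coefD mulrDl IHp IHq.
rewrite -mulrA !gwa_coefCM gwa_coef_mon.
have [->|ik] := eqVneq i k; first by rewrite mulr1.
rewrite (gwa_coef_homogeneous (homogeneousM (homogeneous_mon k) hh)) ?mulr0 ?mul0r //.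
by rewrite (inj_eq (addIr j)).
Qed.

End Coefficients.

(** * Ring-theoretic preliminaries *)

Section Iterates.
Variables (D : pzRingType) (s : {rmorphism D -> D}).

Lemma iter_rmorphM n : {morph iter n s : c d / c * d}.
Proof. by move=> c d; elim: n => //= n ->; rewrite rmorphM. Qed.

Lemma iter_rmorph1 n : iter n s 1 = 1.
Proof. by elim: n => //= n ->; rewrite rmorph1. Qed.

Lemma iter_surj n d : bijective s -> exists e, iter n s e = d.
Proof.
move=> [g _ gK]; exists (iter n g d).
by elim: n d => //= n IHn d; rewrite -iterS iterSr gK.
Qed.

Lemma inj_surj_bij : (forall d, s d = 0 -> d = 0) ->
  (forall c, exists d, s d = c) -> bijective s.
Proof.
move=> s_inj /choice [g gK]; exists g => // d.
by apply/subr0_eq/s_inj; rewrite rmorphB gK subrr.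
Qed.

End Iterates.

Section RingNotionsTheory.
Variable R : pzRingType.

Lemma regularP (d : R) :
  regular d <-> (forall r, d * r = 0 -> r = 0) /\ (forall r, r * d = 0 -> r = 0).
Proof.
split=> [[ndl ndr]|[dl dr]].
  split=> r dr0.
    by apply: contrapT => /eqP r0; apply: ndl; exists r.
  by apply: contrapT => /eqP r0; apply: ndr; exists r.
by split=> -[r /eqP r0]; [move/dl|move/dr].
Qed.

Lemma ideal1 (I : set R) : two_sided_ideal I -> I 1 -> I = setT.
Proof.
by move=> [_ _ IM _] I1; apply/seteqP; split=> // r _; rewrite -[r]mulr1; exact: IM.
Qed.

Lemma simple_ring_iso (S : pzRingType) (g : {rmorphism R -> S}) (h : S -> R) :
  cancel g h -> cancel h g -> simple_ring R -> simple_ring S.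
Proof.
move=> gK hK [R1 Rs]; split=> [S1|J [J0 JD JL JR]].
  by apply: R1; rewrite -[1]gK rmorph1 S1 -(rmorph0 g) gK.
have [] := Rs (g @^-1` J).
- split=> [|r1 r2|r1 r2|r1 r2] /=.
  + by rewrite rmorph0.
  + by rewrite rmorphD; exact: JD.
  + by rewrite rmorphM; exact: JL.
  + by rewrite rmorphM; exact: JR.
- move=> gJ0; left; apply/seteqP; split=> [s Js|s ->] //=.
  have : (g @^-1` J) (h s) by rewrite /preimage /= hK.
  by rewrite gJ0 -{2}[s]hK => ->; rewrite rmorph0.
- move=> gJT; right; apply/seteqP; split=> // s _.
  have : (g @^-1` J) (h s) by rewrite gJT.
  by rewrite /preimage /= hK.
Qed.

End RingNotionsTheory.

Section BaseRing.
Variables (D : pzRingType) (sigma tau : {rmorphism D -> D}) (a : D).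
Hypothesis gwaP : gwa_conditions sigma tau a.
Hypotheses (a_normal : right_normal a) (sa_normal : right_normal (sigma a)).

Lemma gwa_conditions_swap : gwa_conditions tau sigma (sigma a).
Proof.
have [tsa ad sad] := gwaP; split=> [|d|d]; first by rewrite tsa.
  exact: sad.
by rewrite tsa; exact: ad.
Qed.

(** By normality tau(c) a = a d = tau(sigma(d)) a for some d; cancelling tau and
    a together yields c = sigma(d). *)
Lemma twisted_bijective :
    (forall d, sigma d * sigma a = 0 -> d = 0) ->
    (forall d, tau d * a = 0 -> d = 0) ->
  bijective sigma /\ bijective tau.
Proof.
have [tsa ad sad] := gwaP => s_reg t_reg; split; apply: inj_surj_bij.
- by move=> d sd0; apply: s_reg; rewrite sd0 mul0r.
- move=> c; have [d _ dE] : rmultiples a (tau c * a).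
    by apply: a_normal; exists (tau c).
  exists d; apply/esym/subr0_eq/t_reg.
  by rewrite rmorphB mulrBl -ad dE subrr.
- by move=> d td0; apply: t_reg; rewrite td0 mul0r.
- move=> c; have [d _ dE] : rmultiples (sigma a) (sigma c * sigma a).
    by apply: sa_normal; exists (sigma c).
  exists d; apply/esym/subr0_eq/s_reg.
  by rewrite rmorphB mulrBl -sad dE subrr.
Qed.

Lemma twisted_regularP :
  regular a /\ regular (sigma a) <->
  (forall d, sigma d * sigma a = 0 -> d = 0) /\ (forall d, tau d * a = 0 -> d = 0).
Proof.
have [tsa ad sad] := gwaP.
split=> [[/regularP[al ar] /regularP[sl sr]]|[s_reg t_reg]].
  split=> d; first by move/sr => sd; apply: al; rewrite ad sd rmorph0 mul0r.
  by move/ar => td; apply: sl; rewrite sad td rmorph0 mul0r.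
have [[g _ gK] [h _ hK]] := twisted_bijective s_reg t_reg.
have s_inj d : sigma d = 0 -> d = 0 by move=> sd; apply: s_reg; rewrite sd mul0r.
have t_inj d : tau d = 0 -> d = 0 by move=> td; apply: t_reg; rewrite td mul0r.
split; apply/regularP; split=> d.
- by rewrite ad => /t_reg/s_inj.
- by rewrite -[d]hK => /t_reg ->; rewrite rmorph0.
- by rewrite sad => /s_reg/t_inj.
- by rewrite -[d]gK => /s_reg ->; rewrite rmorph0.
Qed.

End BaseRing.

(** * The symmetry between x and y *)

Section Swap.
Variables (D : pzRingType) (sigma tau : {rmorphism D -> D}) (a : D).
Hypothesis gwaP : gwa_conditions sigma tau a.
Local Notation A := (gwa sigma tau a).
Local Notation B := (gwa tau sigma (sigma a)).

Lemma simple_gwa_swap : simple_ring A <-> simple_ring B.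
Proof.
have [tsa ad sad] := gwaP.
have [||||g [gC gX gY] _] := @gwa_universal D sigma tau a B
  (@gwa_const D tau sigma (sigma a)) (gwa_y tau sigma (sigma a)) (gwa_x tau sigma (sigma a)).
- by move=> d; rewrite gwa_yd.
- by move=> d; rewrite gwa_xd.
- by rewrite gwa_xy tsa.
- by rewrite gwa_yx.
have [||||h [hC hX hY] _] := @gwa_universal D tau sigma (sigma a) A
  (@gwa_const D sigma tau a) (gwa_y sigma tau a) (gwa_x sigma tau a).
- by move=> d; rewrite gwa_yd.
- by move=> d; rewrite gwa_xd.
- by rewrite gwa_xy.
- by rewrite gwa_yx tsa.
have gK : cancel g h.
  elim/gwa_ind=> [d|||p q IHp IHq|p q IHp IHq].
  - by rewrite gC hC.
  - by rewrite gX hY.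
  - by rewrite gY hX.
  - by rewrite !rmorphD IHp IHq.
  - by rewrite !rmorphM IHp IHq.
have hK : cancel h g.
  elim/gwa_ind=> [d|||p q IHp IHq|p q IHp IHq].
  - by rewrite hC gC.
  - by rewrite hX gY.
  - by rewrite hY gX.
  - by rewrite !rmorphD IHp IHq.
  - by rewrite !rmorphM IHp IHq.
by split; [exact: simple_ring_iso gK hK|exact: simple_ring_iso hK gK].
Qed.

End Swap.

(** * Simplicity gives sigma-simplicity and regularity *)

Section Ideals.
Variables (D : pzRingType) (sigma tau : {rmorphism D -> D}) (a : D).
Hypothesis gwaP : gwa_conditions sigma tau a.

Local Notation A := (gwa sigma tau a).
Local Notation K := (@gwa_const D sigma tau a).
Local Notation x := (gwa_x sigma tau a).
Local Notation y := (gwa_y sigma tau a).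
Local Notation coef := (@gwa_coef D sigma tau a).
Local Notation v := (gwa_mon sigma tau a).

Lemma gwa_xnd n d : x ^+ n * K d = K (iter n sigma d) * x ^+ n.
Proof.
elim: n d => [|n IHn] d; first by rewrite mul1r mulr1.
by rewrite exprS -mulrA IHn mulrA gwa_xd -mulrA.
Qed.

Lemma gwa_coef_xn n i : coef (x ^+ n) i = (i == n%:Z)%:R.
Proof. exact: (gwa_coef_mon gwaP n). Qed.

Lemma gwa_const_inj d : K d = 0 -> d = 0.
Proof.
by move=> Kd0; have := gwa_coefC gwaP d 0; rewrite Kd0 gwa_coef0 // mulr1.
Qed.

Lemma gwa_ideal (J : set A) :
    J 0 -> (forall p q, J p -> J q -> J (p + q)) ->
    (forall d p, J p -> J (K d * p)) -> (forall p, J p -> J (x * p)) ->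
    (forall p, J p -> J (y * p)) -> (forall d p, J p -> J (p * K d)) ->
    (forall p, J p -> J (p * x)) -> (forall p, J p -> J (p * y)) ->
  two_sided_ideal J.
Proof.
move=> J0 JD JC JX JY CJ XJ YJ; split=> //.
  elim/gwa_ind=> [d|||p q IHp IHq|p q IHp IHq] r Jr; [by auto..| |].
    by rewrite mulrDl; apply: JD; auto.
  by rewrite -mulrA; auto.
elim/gwa_ind=> [d|||p q IHp IHq|p q IHp IHq] r Jr; [by auto..| |].
  by rewrite mulrDr; apply: JD; auto.
by rewrite mulrA; auto.
Qed.

Definition nonneg_over (I : set D) (p : A) : Prop :=
  forall i, I (coef p i) /\ (i < 0 -> coef p i = 0).

(** The ideal of A attached to I: the polynomials in x over I, saturated with
    respect to left multiplication by powers of x. Saturating is what makes it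
    stable under y, although I need not be tau-stable. *)
Definition eventually_over (I : set D) : set A :=
  [set p | exists n, nonneg_over I (x ^+ n * p)].

Section StableIdeal.
Variable I : set D.
Hypotheses (I_ideal : two_sided_ideal I) (I_stable : stable sigma I).

Lemma nonneg_overCM d p : nonneg_over I p -> nonneg_over I (K d * p).
Proof.
have [_ _ IM _] := I_ideal; move=> Sp i; rewrite gwa_coefCM //.
by have [Ip p0] := Sp i; split=> [|/p0 ->]; [exact: IM|rewrite mulr0].
Qed.

Lemma nonneg_overXM p : nonneg_over I p -> nonneg_over I (x * p).
Proof.
have [_ _ _ MI] := I_ideal; move=> Sp i; rewrite gwa_coefXM //.
have [Ip p0] := Sp (i - 1); split=> [|i0].
  by apply/MI/I_stable; exists (coef p (i - 1)).
by rewrite p0 ?rmorph0 ?mul0r //; lia.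
Qed.

Lemma nonneg_overXnM n p : nonneg_over I p -> nonneg_over I (x ^+ n * p).
Proof.
move=> Sp; elim: n => [|n IHn]; first by rewrite mul1r.
by rewrite exprS -mulrA; exact: nonneg_overXM.
Qed.

Lemma nonneg_overM p h j : homogeneous j h -> nonneg_over I p ->
  (forall i, i < 0 -> coef p (i - j) = 0) -> nonneg_over I (p * h).
Proof.
have [_ _ _ MI] := I_ideal; move=> hh Sp p0 i.
rewrite -(subrK j i) (gwa_coefM_homogeneous gwaP _ _ hh) subrK.
split=> [|i0]; first by apply: MI; have [] := Sp (i - j).
by rewrite p0 ?mul0r.
Qed.

(** Multiplication by y on either side is compensated by one more factor x on
    the left, since xy is in D. *)
Lemma eventually_over_ideal : two_sided_ideal (eventually_over I).
Proof.
have [I0 ID IM MI] := I_ideal; apply: gwa_ideal.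
- by exists 0%N => i; rewrite mulr0 gwa_coef0.
- move=> p q [n Sp] [m Sq]; exists (n + m)%N => i.
  rewrite mulrDr gwa_coefD // {1 3}addnC !exprD -!mulrA.
  have [Ip p0] := nonneg_overXnM m Sp i.
  have [Iq q0] := nonneg_overXnM n Sq i.
  by split=> [|i0]; [exact: ID|rewrite p0 ?q0 ?addr0].
- move=> d p [n Sp]; exists n; rewrite mulrA gwa_xnd -mulrA.
  exact: nonneg_overCM.
- move=> p [n Sp]; exists n; rewrite mulrA -exprSr exprS -mulrA.
  exact: nonneg_overXM.
- move=> p [n Sp]; exists n.+1.
  rewrite mulrA exprSr -(mulrA _ x) gwa_xy gwa_xnd -mulrA.
  exact: nonneg_overCM.
- move=> d p [n Sp]; exists n; rewrite mulrA.
  apply: (nonneg_overM (homogeneousC _ _ _ d)) => // i i0.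
  by rewrite subr0; have [_] := Sp i; apply.
- move=> p [n Sp]; exists n; rewrite mulrA.
  apply: (nonneg_overM (homogeneous_mon _ _ _ 1)) => // i i0.
  by have [_] := Sp (i - 1); apply; lia.
- move=> p [n Sp]; exists n.+1; rewrite mulrA exprS -(mulrA x).
  (* The extra x kills the constant term, so y creates no negative degree. *)
  apply: (nonneg_overM (homogeneous_mon _ _ _ (-1))).
    exact: nonneg_overXM.
  move=> i i0; rewrite gwa_coefXM //.
  have [_ ->] := Sp (i - -1 - 1); last by lia.
  by rewrite rmorph0 mul0r.
Qed.

Lemma eventually_overT : eventually_over I = setT -> I = setT.
Proof.
move=> JT; have : eventually_over I 1 by rewrite JT.
move=> [n Sn]; apply: ideal1 => //.
by have [+ _] := Sn n; rewrite mulr1 gwa_coef_xn eqxx.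
Qed.

Lemma eventually_over_const d : I d -> eventually_over I (K d).
Proof.
have [I0 _ _ MI] := I_ideal.
move=> Id; exists 0%N => i; rewrite mul1r gwa_coefC //; split; first exact: MI.
by case: eqP => [->|]; rewrite ?mulr0.
Qed.

End StableIdeal.

Hypothesis A_simple : simple_ring A.

Lemma simple_gwa_base_nonzero : (1 : D) <> 0.
Proof. by have [A1 _] := A_simple; move=> D1; apply: A1; rewrite -(rmorph1 K) D1 rmorph0. Qed.

Lemma simple_gwa_endo_simple : endo_simple sigma.
Proof.
have [A1 As] := A_simple; move=> I I_ideal I_stable.
have [I0 _ _ _] := I_ideal.
have [J0|JT] := As _ (eventually_over_ideal I_ideal I_stable).
  left; apply/seteqP; split=> [d Id|d -> //]; apply: gwa_const_inj.
  by have := eventually_over_const I_ideal Id; rewrite J0.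
by right; exact: eventually_overT JT.
Qed.

(** The elements killed by a power of x form the ideal attached to I = 0. *)
Lemma simple_gwa_x_regular p : x * p = 0 -> p = 0.
Proof.
have [A1 As] := A_simple; move=> xp0.
pose I : set D := [set 0].
have I_ideal : two_sided_ideal I.
  split=> //= [c d -> ->|c d ->|c d ->]; first exact: addr0.
    exact: mulr0.
  exact: mul0r.
have I_stable : stable sigma I by move=> _ [_ -> <-]; exact: rmorph0.
have [J0|JT] := As _ (eventually_over_ideal I_ideal I_stable).
  have : eventually_over I p.
    by exists 1%N; rewrite expr1 xp0 => i; rewrite gwa_coef0.
  by rewrite J0.
have : I 1 by rewrite (eventually_overT I_ideal JT).
by move/simple_gwa_base_nonzero.
Qed.

(** Since x d y = sigma(d) sigma(a), this is the regularity of x tested on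
    d y. *)
Lemma simple_gwa_twisted_regular d : sigma d * sigma a = 0 -> d = 0.
Proof.
move=> sd0; suff Kdy : K d * y = 0.
  have := gwa_coefCmon gwaP d (-1) (-1).
  by rewrite /gwa_mon /= Kdy gwa_coef0 // mulr1.
by apply: simple_gwa_x_regular; rewrite mulrA gwa_xd -mulrA gwa_xy -rmorphM sd0 rmorph0.
Qed.

End Ideals.

(** * Simplicity excludes inner powers of sigma *)

Section InnerPower.
Variables (D : pzRingType) (s : {rmorphism D -> D}).

(** If sigma^i is conjugation by u, then w = u sigma(u) ... sigma^(i-1)(u) is
    fixed by sigma: sigma(w) differs from w by moving the factor u from the left
    end to the right end, and u commutes with w because sigma^i(w) = w. Each
    sigma^j(u) also induces sigma^i, so w induces sigma^(i^2). *)
Lemma inner_iter_fixed_unit i : bijective s -> (1 <= i)%N -> inner (iter i s) ->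
  exists n u v, [/\ (1 <= n)%N, u * v = 1, v * u = 1, s u = u
    & forall d, iter n s d = u * d * v].
Proof.
move=> s_bij i1 [u [v [uv vu sE]]].
have su j : iter i s (iter j s u) = iter j s u.
  by rewrite -iterD addnC iterD sE -mulrA uv mulr1.
pose w k := \prod_(j < k) iter j s u.
have wS k : w k.+1 = w k * iter k s u by rewrite /w big_ord_recr.
have wS' k : w k.+1 = u * s (w k) by rewrite /w big_ord_recl rmorph_prod.
have sw k : iter i s (w k) = w k.
  elim: k => [|k IHk]; first by rewrite /w big_ord0 iter_rmorph1.
  by rewrite wS iter_rmorphM IHk su.
have wP k : exists w', [/\ w k * w' = 1, w' * w k = 1
    & forall d, iter (k * i) s d = w k * d * w'].
  elim: k => [|k [w' [ww' w'w wE]]].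
    by exists 1; rewrite /w big_ord0 mul1r; split=> // d; rewrite mul1r mulr1.
  have uv_k : iter k s u * iter k s v = 1 by rewrite -iter_rmorphM uv iter_rmorph1.
  have vu_k : iter k s v * iter k s u = 1 by rewrite -iter_rmorphM vu iter_rmorph1.
  exists (iter k s v * w'); rewrite wS; split.
  - by rewrite mulrA -(mulrA (w k)) uv_k mulr1.
  - by rewrite mulrA -(mulrA _ w') w'w mulr1.
  move=> d; rewrite mulSn addnC iterD.
  have [e <-] := iter_surj k d s_bij.
  have -> : iter i s (iter k s e) = iter k s (iter i s e).
    by rewrite -!iterD addnC.
  by rewrite wE sE !iter_rmorphM !mulrA.
have [w' [ww' w'w wE]] := wP i.
exists (i * i)%N, (w i), w'; split=> //; first by rewrite muln_gt0 i1.
have wu : w i * u = u * s (w i) by rewrite -wS' wS sE -(mulrA u) uv mulr1.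
have uw : u * w i = w i * u.
  by rewrite -[in RHS](sw i) sE -!mulrA vu mulr1.
by rewrite -[LHS]mul1r -vu -mulrA -wu -uw mulrA vu mul1r.
Qed.

End InnerPower.

Section SimpleToConditions.
Variables (D : pzRingType) (sigma tau : {rmorphism D -> D}) (a : D).
Hypothesis gwaP : gwa_conditions sigma tau a.

Local Notation A := (gwa sigma tau a).
Local Notation K := (@gwa_const D sigma tau a).
Local Notation x := (gwa_x sigma tau a).
Local Notation y := (gwa_y sigma tau a).
Local Notation coef := (@gwa_coef D sigma tau a).
Local Notation v := (gwa_mon sigma tau a).

Section Central.
Variables (n : nat) (u u' : D).
Hypotheses (n_gt0 : (0 < n)%N) (uu' : u * u' = 1) (u'u : u' * u = 1).
Hypotheses (su : sigma u = u) (snE : forall d, iter n sigma d = u * d * u').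
Let z : A := K u' * x ^+ n.

(** Commutation with D and x is built into the choice of u; for y both products
    reduce to multiples of x^(n-1), as sigma^(n-1)(sigma(a)) = u a u^-1. *)
Lemma inner_central p : z * p = p * z.
Proof.
have [tsa ad sad] := gwaP.
have su' : sigma u' = u'.
  by rewrite -[RHS]mul1r -(rmorph1 sigma) -u'u rmorphM su -mulrA uu' mulr1.
elim/gwa_ind: p => [d|||p q IHp IHq|p q IHp IHq].
- rewrite /z -mulrA gwa_xnd snE mulrA -rmorphM.
  by rewrite mulrA mulrA u'u mul1r rmorphM mulrA.
- by rewrite /z -mulrA -exprSr mulrA gwa_xd su' -mulrA -exprS.
- rewrite /z -(prednK n_gt0).
  have snb : iter n.-1 sigma (sigma a) = u * a * u'.
    by rewrite -iterSr prednK.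
  rewrite {1}exprSr exprS -mulrA -(mulrA _ x) gwa_xy gwa_xnd snb.
  rewrite mulrA -rmorphM !mulrA u'u mul1r gwa_yd -(mulrA _ y) gwa_yx.
  by rewrite -rmorphM -{2}su' -ad.
- by rewrite mulrDl mulrDr IHp IHq.
- by rewrite (mulrA z) IHp -(mulrA p) IHq mulrA.
Qed.

(** If p (1 + z) = 1 then p would be the infinite geometric series in -z: its
    coefficients vanish in negative degrees, start with 1 in degree 0, and are
    multiplied by a unit when the degree increases by n. *)
Lemma inner_not_unit p : (1 : D) <> 0 -> p * (1 + z) <> 1.
Proof.
move=> D1 pz1.
have hz : homogeneous n z.
  by exists u'.
have rec (i : int) : coef p i + coef p (i - n%:Z) * coef (v (i - n%:Z) * z) i =
      (i == 0)%:R.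
  rewrite -(gwa_coef1 gwaP) -pz1 mulrDr mulr1 gwa_coefD //; congr (_ + _).
  rewrite -[in RHS](subrK n%:Z i) (gwa_coefM_homogeneous gwaP _ _ hz).
  by rewrite subrK.
have [N pN] := gwa_coef_support gwaP p.
have p_neg i : i < 0 -> coef p i = 0.
  (* Induction upwards from the bottom of the support. *)
  suff: forall k : nat, i < k%:Z - N%:Z -> i < 0 -> coef p i = 0.
    by move=> p0 i0; apply: (p0 N) => //; lia.
  move=> k; elim: k i => [|k IHk] i ik i0; first by apply: pN; lia.
  have := rec i; rewrite (IHk (i - n%:Z)) ?mul0r ?addr0; [|lia|lia].
  by move=> ->; case: eqP => // ?; lia.
have vz (j : nat) : coef (v j * z) (j + n)%N = iter j sigma u'.
  rewrite /= /z mulrA gwa_xnd -mulrA -exprD gwa_coefCM // gwa_coef_xn //.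
  by rewrite eqxx mulr1.
have pk (k : nat) : coef p (k * n)%N != 0.
  elim: k => [|k IHk].
    have := rec 0; rewrite (p_neg (0 - n%:Z)) ?mul0r ?addr0; last by lia.
    by move=> ->; apply/eqP.
  apply: contra IHk => /eqP pS; have := rec (k.+1 * n)%N.
  rewrite pS add0r.
  have -> : (k.+1 * n)%N%:Z - n%:Z = (k * n)%N by lia.
  rewrite mulSn addnC vz.
  have -> : ((k * n + n)%N%:Z == 0) = false by apply/negbTE; lia.
  move=> pu; rewrite -[X in X == 0]mulr1 -(iter_rmorph1 sigma (k * n)) -u'u.
  by rewrite iter_rmorphM mulrA pu mul0r.
have /eqP := pk N.+1; apply; apply: pN.
nia.
Qed.

End Central.

Hypothesis A_simple : simple_ring A.
Hypothesis sigma_bij : bijective sigma.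

Lemma simple_gwa_not_inner i : (1 <= i)%N -> ~ inner (iter i sigma).
Proof.
move=> i1 /(inner_iter_fixed_unit sigma_bij i1) [n [u [u' [n_gt0 uu' u'u su snE]]]].
have D1 := simple_gwa_base_nonzero A_simple.
have [A1 As] := A_simple.
pose z : A := K u' * x ^+ n.
have zC p : (1 + z) * p = p * (1 + z).
  by rewrite mulrDl mulrDr mul1r mulr1 (inner_central n_gt0 uu' u'u su snE).
have [|J0|JT] := As [set p * (1 + z) | p in setT].
- split=> [|_ _ [p _ <-] [q _ <-]|r _ [p _ <-]|r _ [p _ <-]].
  + by exists 0; rewrite ?mul0r.
  + by exists (p + q); rewrite ?mulrDl.
  + by exists (r * p); rewrite ?mulrA.
  + by exists (p * r); rewrite // -!mulrA zC.
- have : [set p * (1 + z) | p in setT] (1 + z) by exists 1; rewrite ?mul1r.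
  rewrite J0 => /= z0; apply: D1.
  have := gwa_coef0 gwaP 0; rewrite -z0 gwa_coefD // gwa_coef1 // eqxx.
  rewrite gwa_coefCM // gwa_coef_xn // (_ : (0 == n%:Z) = false) ?mulr0 ?addr0 //.
  by apply/negbTE; lia.
- have : [set p * (1 + z) | p in setT] 1 by rewrite JT.
  by move=> [p _]; exact: (inner_not_unit n_gt0 u'u).
Qed.

(** * Simplicity gives the comaximality conditions *)

Section Comaximal.
Variable i : nat.
Hypothesis i_gt0 : (0 < i)%N.
Let I := sum_set (lmultiples a) (lmultiples (iter i sigma a)).

(** Surjectivity of sigma makes sigma^i(a) left normal like a. *)
Lemma comaximal_ideal : two_sided_ideal I.
Proof.
have [tsa ad sad] := gwaP; split.
- by exists 0; [exists 0; rewrite ?mul0r|exists 0; rewrite ?mul0r ?addr0; [exists 0; rewrite ?mul0r|]].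
- move=> _ _ [_ [c _ <-] [_ [d _ <-] <-]] [_ [c' _ <-] [_ [d' _ <-] <-]].
  exists ((c + c') * a); first by exists (c + c').
  exists ((d + d') * iter i sigma a); first by exists (d + d').
  by rewrite !mulrDl addrACA.
- move=> r _ [_ [c _ <-] [_ [d _ <-] <-]].
  exists (r * c * a); first by exists (r * c).
  exists (r * d * iter i sigma a); first by exists (r * d).
  by rewrite mulrDr !mulrA.
- move=> r _ [_ [c _ <-] [_ [d _ <-] <-]].
  have [e eE] := iter_surj i r sigma_bij.
  exists (c * tau (sigma r) * a); first by exists (c * tau (sigma r)).
  exists (d * iter i sigma (tau (sigma e)) * iter i sigma a).
    by exists (d * iter i sigma (tau (sigma e))).
  by rewrite mulrDl -!mulrA -ad -iter_rmorphM -ad iter_rmorphM eE.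
Qed.

Lemma comaximal_l c : I (c * a).
Proof.
exists (c * a); first by exists c.
by exists 0; rewrite ?addr0 //; exists 0; rewrite ?mul0r.
Qed.

Lemma comaximal_r c : I (c * iter i sigma a).
Proof.
exists 0; first by exists 0; rewrite ?mul0r.
by exists (c * iter i sigma a); rewrite ?add0r //; exists c.
Qed.

Lemma gwa_xndyn n d : exists e, x ^+ n * K d * y ^+ n = K e.
Proof.
elim: n => [|n [e IHn]]; first by exists d; rewrite mul1r mulr1.
exists (sigma e * sigma a).
have -> : x ^+ n.+1 * K d * y ^+ n.+1 = x * (x ^+ n * K d * y ^+ n) * y.
  by rewrite exprS exprSr !mulrA.
by rewrite IHn gwa_xd -mulrA gwa_xy -(rmorphM K).
Qed.

Lemma gwa_yndxn n d : exists e, y ^+ n.+1 * K d * x ^+ n.+1 = K (e * a).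
Proof.
elim: n => [|n [e IHn]].
  by exists (tau d); rewrite !expr1 gwa_yd -mulrA gwa_yx -(rmorphM K).
exists (tau (e * a)).
have -> : y ^+ n.+2 * K d * x ^+ n.+2 = y * (y ^+ n.+1 * K d * x ^+ n.+1) * x.
  by rewrite exprS (exprSr x) !mulrA.
by rewrite IHn gwa_yd -mulrA gwa_yx -(rmorphM K).
Qed.

(** Moving the innermost pair x d y = sigma(d a) to the left through the other
    x's turns it into a multiple of sigma^i(a). *)
Lemma gwa_xidyi d : exists2 e, I e & x ^+ i * K d * y ^+ i = K e.
Proof.
have [_ _ _ MI] := comaximal_ideal.
have [e eE] := gwa_xndyn i.-1 1.
exists (iter i sigma d * iter i sigma a * e); first exact/MI/comaximal_r.
have -> : x ^+ i * K d * y ^+ i = x ^+ i.-1 * (x * K d * y) * y ^+ i.-1.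
  by rewrite -(prednK i_gt0) (exprSr x) exprS !mulrA.
rewrite gwa_xd -(mulrA _ x) gwa_xy -(rmorphM K) gwa_xnd -mulrA.
move: eE; rewrite rmorph1 mulr1 => ->.
by rewrite -(rmorphM K) iter_rmorphM -!iterSr prednK.
Qed.

(** Whatever the signs of k and j, the degree 0 product v_k x^i d v_j contains
    either a block x^i ... y^i, giving a factor sigma^i(a), or a block
    y^l ... x^l with l > 0, giving a factor a. *)
Lemma gwa_coef0_xi (k j : int) d : k + i%:Z + j = 0 ->
  I (coef (v k * x ^+ i * (K d * v j)) 0).
Proof.
have [_ _ IM MI] := comaximal_ideal => kij.
suff [e Ie ->] : exists2 e, I e & v k * x ^+ i * (K d * v j) = K e.
  by rewrite gwa_coefC // eqxx mulr1.
case: k j kij => [k|k] [j|j] kij.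
- lia.
- have -> : v (Negz j) = y ^+ k * y ^+ i by rewrite /= -exprD; congr (_ ^+ _); lia.
  have [e eE] := gwa_xndyn k d.
  have [e' Ie' e'E] := gwa_xidyi e.
  by exists e' => //; rewrite -e'E -eE /= -exprD addnC exprD !mulrA.
- have [e eE] := gwa_yndxn (i + j).-1 (iter i sigma d).
  exists (e * a); first exact: comaximal_l.
  move: eE; rewrite prednK ?ltn_addr // (exprD x) mulrA => <-.
  have -> : v (Negz k) = y ^+ (i + j) by rewrite /=; congr (_ ^+ _); lia.
  by rewrite /= -!mulrA (mulrA (x ^+ i)) gwa_xnd !mulrA.
- have iE : i = (k.+1 + j.+1)%N by lia.
  have [e eE] := gwa_yndxn k 1.
  have [e' e'E] := gwa_xndyn j.+1 d.
  exists (e * a * e'); first exact/MI/comaximal_l.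
  have -> : K (e * a * e') = K (e * a) * K e' by exact: rmorphM.
  by rewrite -eE -e'E rmorph1 mulr1 /= iE exprD !mulrA.
Qed.

(** The largest ideal of A whose elements have their constant terms in I
    contains x^i, so it is all of A. *)
Lemma simple_gwa_comaximal : I = setT.
Proof.
have I_ideal := comaximal_ideal.
have [I0 ID IM MI] := I_ideal.
have [A1 As] := A_simple.
pose L : set A := [set p | forall q r, I (coef (q * p * r) 0)].
have Lx : L (x ^+ i).
  move=> q r; elim/gwa_homogeneous_ind: r => [|r1 r2 I1 I2|d j].
  - by rewrite mulr0 gwa_coef0.
  - by rewrite mulrDr gwa_coefD //; exact: ID.
  have hh : homogeneous (i%:Z + j) (x ^+ i * (K d * v j)).
    apply: homogeneousM; first exact: homogeneous_mon _ _ _ (Posz i).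
    exact/homogeneousCM/homogeneous_mon.
  rewrite -mulrA -(addNr (i%:Z + j)) (gwa_coefM_homogeneous gwaP _ _ hh).
  apply: IM; rewrite addNr mulrA; apply: gwa_coef0_xi; lia.
have [|L0|LT] := As L.
- split=> [q r|p1 p2 L1 L2 q r|s p Lp q r|s p Lp q r].
  + by rewrite mulr0 mul0r gwa_coef0.
  + by rewrite mulrDr mulrDl gwa_coefD //; exact: ID.
  + by rewrite mulrA.
  + by rewrite mulrA -mulrA.
- have : L (x ^+ i) by [].
  rewrite L0 => /= xi0; have := gwa_coef_xn gwaP i i.
  by rewrite xi0 gwa_coef0 // eqxx => /esym/(simple_gwa_base_nonzero A_simple).
- have : L 1 by rewrite LT.
  move=> /(_ 1 1); rewrite !mulr1 gwa_coef1 // eqxx; exact: ideal1.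
Qed.

End Comaximal.
End SimpleToConditions.

(** * The conditions imply simplicity *)

Section ConditionsToSimple.
Variables (D : pzRingType) (sigma tau : {rmorphism D -> D}) (a : D).
Hypothesis gwaP : gwa_conditions sigma tau a.

Local Notation A := (gwa sigma tau a).
Local Notation K := (@gwa_const D sigma tau a).
Local Notation x := (gwa_x sigma tau a).
Local Notation y := (gwa_y sigma tau a).
Local Notation coef := (@gwa_coef D sigma tau a).
Local Notation v := (gwa_mon sigma tau a).

Lemma gwa_coefMC p r i : coef (p * K r) i = coef p i * coef (v i * K r) i.
Proof.
by have := gwa_coefM_homogeneous gwaP p i (homogeneousC _ _ _ r); rewrite addr0.
Qed.

Lemma gwa_coefMC_nat p r (i : nat) : coef (p * K r) i = coef p i * iter i sigma r.
Proof. by rewrite gwa_coefMC /= gwa_xnd gwa_coefCM // gwa_coef_xn // eqxx mulr1. Qed.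

Lemma gwa_coefMXn p k i :
  coef (p * x ^+ k) i = coef p (i - k%:Z) * coef (v (i - k%:Z) * x ^+ k) i.
Proof.
have := gwa_coefM_homogeneous gwaP p (i - k%:Z) (homogeneous_mon _ _ _ (Posz k)).
by rewrite subrK.
Qed.

Lemma gwa_coefMXn_nat p k (i : nat) : coef (p * x ^+ k) (i + k)%N = coef p i.
Proof.
rewrite gwa_coefMXn PoszD addrK /= -exprD gwa_coef_xn // PoszD eqxx.
exact: mulr1.
Qed.

Lemma gwa_coefXM_nat p (i : nat) : coef (x * p) i.+1 = sigma (coef p i).
Proof.
rewrite gwa_coefXM // (_ : i.+1%:Z - 1 = i); last by lia.
exact: mulr1.
Qed.

Definition supported_in (m n : nat) (p : A) : Prop :=
  forall i : int, i < m%:Z \/ (m + n)%N%:Z < i -> coef p i = 0.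

Lemma supported_inMXn m n p k :
  supported_in m n p -> supported_in (m + k) n (p * x ^+ k).
Proof.
by move=> pmn i imn; rewrite gwa_coefMXn pmn ?mul0r //; lia.
Qed.

Lemma supported_inXM m n p : supported_in m n p -> supported_in m.+1 n (x * p).
Proof.
by move=> pmn i imn; rewrite gwa_coefXM // pmn ?rmorph0 ?mul0r //; lia.
Qed.

Lemma supported_inMC m n p r : supported_in m n p -> supported_in m n (p * K r).
Proof. by move=> pmn i imn; rewrite gwa_coefMC pmn ?mul0r. Qed.

Lemma supported_inCM m n p r : supported_in m n p -> supported_in m n (K r * p).
Proof. by move=> pmn i imn; rewrite gwa_coefCM // pmn ?mulr0. Qed.

Lemma supported_inD m n p q :
  supported_in m n p -> supported_in m n q -> supported_in m n (p + q).
Proof. by move=> pmn qmn i imn; rewrite gwa_coefD // pmn ?qmn ?addr0. Qed.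

Hypothesis D_nonzero : (1 : D) <> 0.
Hypothesis sigma_bij : bijective sigma.
Hypothesis twisted_regular : forall d, sigma d * sigma a = 0 -> d = 0.
Hypothesis D_simple : endo_simple sigma.
Hypothesis not_inner : forall i, (1 <= i)%N -> ~ inner (iter i sigma).
Hypothesis comaximal : forall i, (1 <= i)%N ->
  sum_set (lmultiples a) (lmultiples (iter i sigma a)) = setT.

Lemma gwa_x_regular p : x * p = 0 -> p = 0.
Proof.
move=> xp0; apply: (gwa_coef_inj gwaP) => i; apply: twisted_regular.
have := gwa_coefXM gwaP p (i + 1); rewrite xp0 gwa_coef0 // addrK.
by case: ifP => // _; rewrite mulr1 => <-; rewrite mul0r.
Qed.

Section Ideal.
Variable J : set A.
Hypothesis J_ideal : two_sided_ideal J.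

(** Left multiplication by a large power of x, which is injective, moves the
    support to nonnegative degrees. *)
Lemma exists_supported_in p : J p -> p <> 0 ->
  exists n m q, [/\ J q, q <> 0 & supported_in m n q].
Proof.
have [_ _ JM _] := J_ideal; move=> Jp p0.
have [N pN] := gwa_coef_support gwaP p.
exists (N + N)%N, 0%N, (x ^+ N * p); split; first exact: JM.
  by elim: N {pN} => [|N IHN]; rewrite ?mul1r // exprS -mulrA => /gwa_x_regular.
have : forall k i, i < k%:Z - N%:Z \/ k%:Z + N%:Z < i -> coef (x ^+ k * p) i = 0.
  elim=> [|k IHk] i ik; first by rewrite mul1r pN //; lia.
  by rewrite exprS -mulrA gwa_coefXM // IHk ?rmorph0 ?mul0r //; lia.
by move=> H i iN; apply: H; lia.
Qed.

(** The lowest degree m is left free: left multiplication by x raises it while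
    applying sigma to the coefficient, which is how sigma-stability arises. *)
Definition lowest_coefs n : set D :=
  [set d | exists m p, [/\ J p, supported_in m n p & coef p m = d]].

(** Two elements with different m are aligned before being added by right
    multiplication by powers of x, which does not change the coefficients. *)
Lemma lowest_coefs_ideal n : two_sided_ideal (lowest_coefs n).
Proof.
have [J0 JD JM MJ] := J_ideal; split.
- by exists 0%N, 0; split; rewrite ?gwa_coef0 // => i _; rewrite gwa_coef0.
- move=> _ _ [m [p [Jp pmn <-]]] [k [q [Jq qkn <-]]].
  exists (m + k)%N, (p * x ^+ k + q * x ^+ m); split.
  + by apply: JD; apply: MJ.
  + apply: supported_inD; first exact: supported_inMXn.
    by rewrite addnC; exact: supported_inMXn.
  + by rewrite gwa_coefD // gwa_coefMXn_nat addnC gwa_coefMXn_nat.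
- move=> r _ [m [p [Jp pmn <-]]]; exists m, (K r * p); split.
  + exact: JM.
  + exact: supported_inCM.
  + by rewrite gwa_coefCM.
- move=> r _ [m [p [Jp pmn <-]]].
  have [e <-] := iter_surj m r sigma_bij.
  exists m, (p * K e); split.
  + exact: MJ.
  + exact: supported_inMC.
  + by rewrite gwa_coefMC_nat.
Qed.

Lemma lowest_coefs_stable n : stable sigma (lowest_coefs n).
Proof.
have [J0 JD JM MJ] := J_ideal.
move=> _ [_ [m [p [Jp pmn <-]]] <-]; exists m.+1, (x * p); split.
- exact: JM.
- exact: supported_inXM.
- by rewrite gwa_coefXM_nat.
Qed.

(** The minimal length argument: an element of J of minimal length with lowest
    coefficient 1 commutes with D up to a twist, and with x, so that its highest
    coefficient would make a power of sigma inner unless the length is 0. *)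
Lemma exists_xn : (exists2 p, J p & p <> 0) -> exists m, J (x ^+ m).
Proof.
have [J0 JD JM MJ] := J_ideal.
have JB p q : J p -> J q -> J (p - q).
  by move=> Jp Jq; apply: JD => //; rewrite -mulN1r; exact: JM.
move=> [p1 Jp1 /(exists_supported_in Jp1) ex_n].
pose Q n := exists m q, [/\ J q, q <> 0 & supported_in m n q].
have [n0 Qn0] : exists n, `[< Q n >].
  by have [n Qn] := ex_n; exists n; apply/asboolP.
have [n /asboolP Qn n_min] := ex_minnP (ex_intro (fun n => `[< Q n >]) n0 Qn0).
(* Bounded by k and k + n - 1: strictly shorter than the minimal length. *)
have small k q : J q ->
    (forall i : int, i < k%:Z \/ (k + n)%N%:Z <= i -> coef q i = 0) -> q = 0.
  move=> Jq q0; have [n_eq0|n_gt0] := posnP n.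
    by apply: (gwa_coef_inj gwaP) => i; apply: q0; lia.
  apply: contrapT => qN0; suff : (n <= n.-1)%N by lia.
  apply/n_min/asboolP; exists k, q; split=> // i ikn; apply: q0; lia.
have [p [m [Jp pmn pm1]]] : exists p m, [/\ J p, supported_in m n p & coef p m = 1].
  have [I0|IT] := D_simple (lowest_coefs_ideal n) (@lowest_coefs_stable n).
    have [m [q [Jq q0 qmn]]] := Qn.
    have qm0 : coef q m = 0.
      by have : lowest_coefs n (coef q m); [exists m, q|rewrite I0].
    case: q0; apply: (small m.+1) => // i ikn.
    by have [->//|im] := eqVneq i m; apply: qmn; lia.
  have : lowest_coefs n 1 by rewrite IT.
  by move=> [m [p [? ? ?]]]; exists p, m.
pose c := coef p (m + n)%N.
(* With sigma^m(e) = r, the terms of degree m of p e and r p cancel. *)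
have c_comm r : c * iter n sigma r = r * c.
  have [e eE] := iter_surj m r sigma_bij.
  suff /(congr1 (fun q => coef q (m + n)%N)) : p * K e - K r * p = 0.
    rewrite gwa_coefB // gwa_coefMC_nat gwa_coefCM // addnC iterD eE addnC.
    by rewrite gwa_coef0 // => /subr0_eq.
  apply: (small m.+1); first by apply: JB; [exact: MJ|exact: JM].
  move=> i ikn; rewrite gwa_coefB // gwa_coefCM //.
  have [->|im] := eqVneq i m.
    by rewrite gwa_coefMC_nat eE pm1 mul1r mulr1 subrr.
  by rewrite gwa_coefMC pmn ?mul0r ?mulr0 ?subrr //; lia.
have sc : sigma c = c.
  suff /(congr1 (fun q => coef q (m + n).+1)) : x * p - p * x = 0.
    rewrite gwa_coefB // gwa_coefXM_nat -[in p * x](expr1 x).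
    by rewrite -(addn1 (m + n)) gwa_coefMXn_nat gwa_coef0 // => /subr0_eq.
  apply: (small m.+2); first by apply: JB; [exact: JM|exact: MJ].
  move=> i ikn; rewrite gwa_coefB //.
  have [->|im] := eqVneq i m.+1.
    rewrite gwa_coefXM_nat -[in p * x](expr1 x) -(addn1 m).
    by rewrite gwa_coefMXn_nat pm1 rmorph1 subrr.
  rewrite -[in p * x](expr1 x) gwa_coefMXn gwa_coefXM //.
  by rewrite pmn ?rmorph0 ?mul0r ?subrr //; lia.
have [n_eq0|n_gt0] := posnP n.
  exists m; suff -> : x ^+ m = p by [].
  apply/esym/subr0_eq/(gwa_coef_inj gwaP) => i; rewrite gwa_coefB // gwa_coef_xn //.
  have [->|im] := eqVneq i m; first by rewrite pm1 subrr.
  by rewrite pmn ?subr0 //; lia.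
have c_neq0 : c <> 0.
  move=> c0; apply: D_nonzero; rewrite -pm1 (small m p) ?gwa_coef0 // => i ikn.
  by have [->//|im] := eqVneq i (m + n)%N; apply: pmn; lia.
have [||Dc0|DcT] := D_simple (I := lmultiples c).
- split=> [|_ _ [r _ <-] [s _ <-]|r _ [s _ <-]|r _ [s _ <-]].
  + by exists 0; rewrite ?mul0r.
  + by exists (r + s); rewrite ?mulrDl.
  + by exists (r * s); rewrite ?mulrA.
  + have [e <-] := iter_surj n r sigma_bij.
    by exists (s * e); rewrite // -!mulrA c_comm.
- by move=> _ [_ [r _ <-] <-]; exists (sigma r); rewrite // rmorphM sc.
- by case: c_neq0; have : lmultiples c c; [exists 1; rewrite ?mul1r|rewrite Dc0].
have [u _ uc] : lmultiples c 1 by rewrite DcT.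
(* The right inverse sigma^n(u) of c must agree with its left inverse u. *)
have cu : c * u = 1.
  have cu' : c * iter n sigma u = 1 by rewrite c_comm.
  suff -> : u = iter n sigma u by [].
  by rewrite -[LHS]mulr1 -cu' mulrA uc mul1r.
case: (not_inner n_gt0); exists u, c; split=> // r.
by rewrite -mulrA -c_comm mulrA uc mul1r.
Qed.

(** Both y x^(m+1) and x^(m+1) y are multiples of x^m, with the comaximal
    coefficients a and sigma^(m+1)(a). *)
Lemma xn_ideal1 m : J (x ^+ m) -> J 1.
Proof.
have [J0 JD JM MJ] := J_ideal.
elim: m => [//|m IHm] Jx; apply: IHm.
have [_ [c _ <-] [_ [d _ <-] cd1]] :
    sum_set (lmultiples a) (lmultiples (iter m.+1 sigma a)) 1 by rewrite comaximal.
have -> : x ^+ m = K c * (y * x ^+ m.+1) + K d * (x ^+ m.+1 * y).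
  have -> : y * x ^+ m.+1 = K a * x ^+ m by rewrite exprS mulrA gwa_yx.
  have -> : x ^+ m.+1 * y = K (iter m.+1 sigma a) * x ^+ m.
    by rewrite exprSr -mulrA gwa_xy gwa_xnd -iterSr.
  by rewrite !mulrA -mulrDl -!(rmorphM K) -(rmorphD K) cd1 rmorph1 mul1r.
by apply: JD; apply/JM; [exact: JM|exact: MJ].
Qed.

End Ideal.

Lemma simple_gwa : simple_ring A.
Proof.
split=> [A1|J J_ideal]; first exact/D_nonzero/(gwa_const_inj gwaP).
have [J0 _ _ _] := J_ideal.
have [/(exists_xn J_ideal) [m /(xn_ideal1 J_ideal) J1]|noJ] :=
  pselect (exists2 p, J p & p <> 0).
  by right; exact: ideal1.
left; apply/seteqP; split=> [p Jp|p -> //].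
by apply: contrapT => p0; apply: noJ; exists p.
Qed.

End ConditionsToSimple.

Lemma simple_gwa_iff (D : pzRingType) (sigma tau : {rmorphism D -> D}) (a : D)
    (gwaP : gwa_conditions sigma tau a)
    (a_normal : right_normal a) (sa_normal : right_normal (sigma a)) :
  simple_ring (gwa sigma tau a) <->
    [/\ regular a /\ regular (sigma a),
        endo_simple sigma,
        forall i : nat, (1 <= i)%N -> ~ inner (iter i sigma) &
        forall i : nat, (1 <= i)%N ->
          sum_set (lmultiples a) (lmultiples (iter i sigma a)) = setT].
Proof.
have regP := twisted_regularP gwaP a_normal sa_normal.
split=> [As|[/regP[s_reg t_reg] Ds ninn comax]].
  have s_reg := simple_gwa_twisted_regular gwaP As.
  have t_reg d : tau d * a = 0 -> d = 0.
    have [tsa _ _] := gwaP; rewrite -{1}tsa.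
    apply: (simple_gwa_twisted_regular (gwa_conditions_swap gwaP)).
    exact/(simple_gwa_swap gwaP).
  have [s_bij _] := twisted_bijective gwaP a_normal sa_normal s_reg t_reg.
  split.
  - exact/regP.
  - exact: simple_gwa_endo_simple As.
  - by move=> i; exact: (simple_gwa_not_inner gwaP As s_bij).
  - by move=> i i1; exact: (simple_gwa_comaximal gwaP As s_bij i1).
have [s_bij _] := twisted_bijective gwaP a_normal sa_normal s_reg t_reg.
(* The identity of the zero ring is inner. *)
apply: simple_gwa => // D1; apply: (ninn 1%N) => //; exists 0, 0.
by split=> [||d]; rewrite ?mul0r ?D1 // -[LHS]mul1r D1 !mul0r.
Qed.

Theorem theorem1p1 (D : pzRingType) (sigma tau : {rmorphism D -> D}) (a : D)
    (gwaP : gwa_conditions sigma tau a)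
    (a_normal : right_normal a) (sa_normal : right_normal (sigma a)) :
  let cond1 := simple_ring (gwa sigma tau a) in
  let cond2 :=
    [/\ regular a /\ regular (sigma a),
        endo_simple sigma,
        forall i : nat, (1 <= i)%N -> ~ inner (iter i sigma) &
        forall i : nat, (1 <= i)%N ->
          sum_set (lmultiples a) (lmultiples (iter i sigma a)) = setT] in
  let cond3 :=
    [/\ regular a /\ regular (sigma a),
        endo_simple tau,
        forall i : nat, (1 <= i)%N -> ~ inner (iter i tau) &
        forall i : nat, (1 <= i)%N ->
          sum_set (lmultiples (sigma a)) (lmultiples (iter i tau (sigma a)))
            = setT] in
  [/\ cond1 <-> cond2,
      cond1 <-> cond3 &
      cond1 \/ cond2 \/ cond3 -> bijective sigma /\ bijective tau].
Proof.
move=> cond1 cond2 cond3; have [tsa _ _] := gwaP.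
have regP := twisted_regularP gwaP a_normal sa_normal.
split.
- exact: simple_gwa_iff.
- have := simple_gwa_iff (gwa_conditions_swap gwaP) sa_normal.
  rewrite tsa => /(_ a_normal) swapP.
  apply: iff_trans (simple_gwa_swap gwaP) _; apply: iff_trans swapP _.
  by split=> -[[? ?] ? ? ?].
- suff reg : regular a /\ regular (sigma a) -> bijective sigma /\ bijective tau.
    by move=> [/(simple_gwa_iff gwaP a_normal sa_normal)[/reg]|[[/reg]|[/reg]]].
  by move=> /regP[]; exact: twisted_bijective.
Qed.
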